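(* Let $\mathbf{w} \in \mathbb{Q}^{k+1}$ be a partial weighting vector with respect to $\lambda = (1^k, n-k)$, where $1 \le k \le n-2$, and let $\tau \in \mathbb{Q}$ with $0 \le \tau \le 1$. The positional map $T_{\mathbf{w}}$ is recoverable from the map $P^k_\tau$ if and only if $\widehat{\overline{\mathbf{w}}}$ is a linear combination of $\widehat{\overline{\mathbf{b}}}$ and $\widehat{\overline{\mathbf{b}^\tau}}$.
   Context: Candidates are labelled $1,\dots,n$. $\lambda = (1^k, n-k)$ denotes the composition $(1,\dots,1,n-k)$ of $n$ with $k$ ones. A tabloid of shape $\lambda$ is an ordered list of $k$ distinct candidates (the 1st through $k$th rows, in order of preference) together with the unordered set of the remaining $n-k$ candidates (the $(k+1)$st row, all tied for last place). $M^{(1^k,n-k)}$ is the $\mathbb{Q}$-vector space with basis these tabloids. A partial weighting vector with respect to $\lambda$ is $\mathbf{w} = [w_1,\dots,w_{k+1}]^t \in \mathbb{Q}^{k+1}$; the positional map $T_{\mathbf{w}}: M^{(1^k,n-k)} \to \mathbb{Q}^n$ is the linear map sending a tabloid to the vector whose $i$th coordinate is $w_j$, where $j$ is the row containing candidate $i$. $\overline{\mathbf{w}} \in \mathbb{Q}^n$ is the vector whose first $k$ entries are $w_1,\dots,w_k$ and whose last $n-k$ entries all equal $w_{k+1}$. For $\mathbf{v} \in \mathbb{Q}^n$, $\widehat{\mathbf{v}} = \mathbf{v} - \frac1n\left(\sum_i v_i\right)\mathbf{1}$ is its orthogonal projection onto the subspace of vectors whose entries sum to zero ($\mathbf{1}$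 is the all-ones vector). $M^{(1,1,n-2)}$ is the $\mathbb{Q}$-vector space with basis the ordered pairs $(i,j)$ of distinct candidates. The map $P^k_\tau: M^{(1^k,n-k)} \to M^{(1,1,n-2)}$ is the linear map sending a tabloid $x$ to the vector whose coefficient at $(i,j)$ is $1$ if $i$ is in a higher-ranked (smaller-index) row of $x$ than $j$, is $0$ if $j$ is in a higher-ranked row than $i$, and is $\tau$ if $i$ and $j$ are both in the last row of $x$. The vector $\mathbf{b} = [b_1,\dots,b_{k+1}]^t$ is defined by $b_i = n-i$ for $1 \le i \le k$ and $b_{k+1} = \frac12(n-k-1)$. The vector $\mathbf{b}^\tau = [b^\tau_1,\dots,b^\tau_{k+1}]^t$ is defined by $b^\tau_i = n-i$ for $1 \le i \le k$ and $b^\tau_{k+1} = \tau(n-k-1)$. For linear maps $T: V \to W$ and $T': V \to U$ on the same vector space $V$, $T'$ is recoverable from $T$ if there exists a linear map $R: W \to U$ with $T' = R \circ T$. *)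

(* Defs.v *)
From HB Require Import structures.
From mathcomp Require Import all_boot all_order all_algebra.

Set Implicit Arguments.
Unset Strict Implicit.
Unset Printing Implicit Defensive.

Import GRing.Theory.
Local Open Scope ring_scope.

(* The Q-vector space with basis B is {ffun B -> rat^o}; the basis vector b is
   the function with value 1 at b and 0 elsewhere. [linext F] is the linear map
   sending each basis vector b to F b (see linext_basis). *)
Section LinearExtension.
Variables (B : finType) (V : lmodType rat) (F : B -> V).

Definition linext (x : {ffun B -> rat^o}) : V := \sum_(b : B) x b *: F b.

Fact linext_is_linear : linear linext.
Proof.
move=> a x y; rewrite /linext scaler_sumr -big_split /=.
by apply: eq_bigr => b _; rewrite !ffunE scalerDl scalerA.
Qed.

HB.instance Definition _ :=
  GRing.isLinear.Build rat {ffun B -> rat^o} V *:%R linext linext_is_linear.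

Lemma linext_basis (b : B) : linext [ffun c => (c == b)%:R] = F b.
Proof.
rewrite /linext (bigD1 b) //= big1 ?addr0 ?ffunE ?eqxx ?scale1r // => c ncb.
by rewrite ffunE (negPf ncb) scale0r.
Qed.

End LinearExtension.

Definition recoverable (V W U : lmodType rat)
    (T' : {linear V -> U}) (T : {linear V -> W}) : Prop :=
  exists R : {linear W -> U}, T' =1 R \o T.

(* Candidates and rows are numbered from 0. A tabloid of shape (1^k, n-k) is
   given by its top k rows; its last row, of index k, consists of the
   candidates that are not listed. *)
Definition tabloid (n k : nat) : Type := {t : k.-tuple 'I_n | uniq t}.
HB.instance Definition _ (n k : nat) := Finite.on (tabloid n k).

(* [index i s] is [size s], here k, when i does not occur in s. *)
Definition row_of (n k : nat) (t : tabloid n k) (i : 'I_n) : 'I_k.+1 :=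
  inord (index i (val t)).

Definition positional (n k : nat) (w : 'cV[rat]_k.+1) :
    {linear {ffun tabloid n k -> rat^o} -> 'cV[rat]_n} :=
  linext (fun t : tabloid n k => \col_(i < n) w (row_of t i) 0).

Definition cand_pair (n : nat) : Type := {p : 'I_n * 'I_n | p.1 != p.2}.
HB.instance Definition _ (n : nat) := Finite.on (cand_pair n).

Definition pairs_vector (n k : nat) (tau : rat) (t : tabloid n k) :
    {ffun cand_pair n -> rat^o} :=
  [ffun p : cand_pair n =>
     let i := (val p).1 in let j := (val p).2 in
     if (row_of t i < row_of t j)%N then 1
     else if (row_of t j < row_of t i)%N then 0
     else tau].

Definition pairs_map (n k : nat) (tau : rat) :
    {linear {ffun tabloid n k -> rat^o} -> {ffun cand_pair n -> rat^o}} :=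
  linext (@pairs_vector n k tau).

Definition extend (n k : nat) (w : 'cV[rat]_k.+1) : 'cV[rat]_n :=
  \col_(i < n) if (i < k)%N then w (inord i) 0 else w ord_max 0.

Definition hat (n : nat) (v : 'cV[rat]_n) : 'cV[rat]_n :=
  v - (n%:R^-1 * \sum_(i < n) v i 0) *: const_mx 1.

(* With 0-based rows, the entry n - i of row i becomes n - i.+1. *)
Definition borda (n k : nat) : 'cV[rat]_k.+1 :=
  \col_(i < k.+1) if (i < k)%N then n%:R - i.+1%:R
                  else 2%:R^-1 * (n%:R - k%:R - 1).

Definition borda_tau (n k : nat) (tau : rat) : 'cV[rat]_k.+1 :=
  \col_(i < k.+1) if (i < k)%N then n%:R - i.+1%:R
                  else tau * (n%:R - k%:R - 1).

(* Main.v *)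
Require Import Defs.
From mathcomp Require Import all_boot all_order all_algebra.
From mathcomp Require Import perm ring lra zify.

(** Fix a tabloid and a candidate [i] in row [r]. In the vector of pairs of that
    tabloid, the entries at the pairs [(i, j)] add up to [borda_tau] at [r],
    while those at the pairs [(j, i)] add up to
    [borda_tau - 2 * borda + (n - 1)] at [r] ([sum_pref_row], [sum_pref_col]).
    The sum of all the entries is a constant that does not depend on the tabloid
    ([sum_pref]), and it is positive because the first row wins [n - 1]
    comparisons and no entry is negative. So the score vectors [borda],
    [borda_tau] and [1] are all read off linearly from the pairs, which gives one
    direction ([recoverable_of_weights]).

    Conversely, if [T_w] is recoverable, then for a fixed [i] the weight of the
    row of [i] is a linear combination of the entries at the pairs, the same for
    all tabloids. Add these equations up over all tabloids that have [i] in row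
    [r]. The permutations of the candidates that fix [i] act on these tabloids,
    and they have three orbits on pairs: [i] first, [i] second, [i] absent. Hence
    the summed entry depends only on the orbit of the pair, and the combination
    depends only on the three orbit sums, which are those computed above.
    Therefore [w] is a combination of [borda], [borda_tau] and [1]
    ([weights_of_recoverable]).

    Finally, [hat] kills exactly the constant vectors, so being a combination of
    the three weighting vectors is the same as the spanning condition on the
    projected ones ([hat_extend_span]). *)

Set Implicit Arguments.
Unset Strict Implicit.
Unset Printing Implicit Defensive.

Import Order.TTheory GRing.Theory Num.Theory.
Local Open Scope ring_scope.

(** * Row sizes and scores of a tabloid *)

(** The entries of [pairs_vector], also defined on the diagonal, where the value
    is [tau]: sums over [j != i] are sums over all [j] minus [tau]. *)
Definition pref (n k : nat) (tau : rat) (t : tabloid n k) (i j : 'I_n) : rat :=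
  if (row_of t i < row_of t j)%N then 1
  else if (row_of t j < row_of t i)%N then 0
  else tau.

Lemma pref_diag n k tau (t : tabloid n k) i : pref tau t i i = tau.
Proof. by rewrite /pref ltnn. Qed.

Lemma row_ofE n k (t : tabloid n k) i : row_of t i = index i (val t) :> nat.
Proof.
rewrite /row_of inordK // ltnS; have := index_size i (val t).
by rewrite size_tuple.
Qed.

(** Rows [0..r-1] hold the first [r] entries of the list of top candidates; this
    also holds for the last row, [r = k]. *)
Lemma card_row_lt n k (t : tabloid n k) (r : 'I_k.+1) :
  #|[pred j | (row_of t j < r)%N]| = r.
Proof.
have ut : uniq (take r (val t)) by apply/take_uniq/(valP t).
rewrite (eq_card (B := mem (take r (val t)))) => [|j]; last first.
  rewrite !inE row_ofE; have [jt|jt] := boolP (j \in (val (val t))).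
    by rewrite in_take.
  have /negPf-> : j \notin take r (val t) by apply: contra jt => /mem_take.
  apply/negbTE; rewrite -leqNgt (memNindex jt) size_tuple.
  by rewrite -ltnS.
by rewrite (card_uniqP ut) size_takel // size_tuple -ltnS.
Qed.

Definition row_size (n k : nat) (r : nat) : nat := (if r < k then 1 else n - k)%N.

Lemma card_row_gt n k (t : tabloid n k) (r : 'I_k.+1) :
  (k < n)%N ->
  (#|[pred j | (r < row_of t j)%N]| + r + row_size n k r = n)%N.
Proof.
move=> lekn; rewrite /row_size; case: ltnP => hr.
  have := card_row_lt t (Ordinal (hr : (r.+1 < k.+1)%N)) => /= E.
  have := cardC [pred j | (row_of t j < r.+1)%N].
  rewrite E card_ord [X in (_ + X)%N](eq_card (B := [pred j | (r < row_of t j)%N])).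
    by rewrite -addnA addn1 addnC.
  by move=> j; rewrite !inE -leqNgt.
rewrite eq_card0 => [|j]; last first.
  by rewrite !inE; apply/negbTE; rewrite -leqNgt; apply: leq_trans hr; rewrite -ltnS.
have := ltn_ord r; lia.
Qed.

Lemma card_row n k (t : tabloid n k) (r : 'I_k.+1) :
  (k < n)%N -> #|[pred j | row_of t j == r]| = row_size n k r.
Proof.
move=> lekn.
have : (#|[pred j | (row_of t j < r)%N]| + #|[pred j | row_of t j == r]|
        + #|[pred j | (r < row_of t j)%N]| = n)%N.
  rewrite -[RHS]card_ord -!sum1_card.
  rewrite [X in (X + _ + _)%N]big_mkcond [X in (_ + X + _)%N]big_mkcond.
  rewrite [X in (_ + X)%N = _]big_mkcond -!big_split /=.
  apply: eq_bigr => j _; rewrite !inE -(inj_eq val_inj) /=.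
  by case: ltngtP.
rewrite card_row_lt.
have := card_row_gt t r lekn; lia.
Qed.

Lemma sum_nat_bool (T : finType) (Q : pred T) :
  \sum_(x : T) ((Q x)%:R : rat) = #|Q|%:R.
Proof.
rewrite -sumr_const [RHS]big_mkcond /=.
by apply: eq_bigr => x _; case: ifP; rewrite unfold_in => ->.
Qed.

(** A candidate in row [r] gets [1] for each candidate below row [r] and [tau] for
    each other candidate of row [r], which is possible only in the last row. *)
Lemma sum_pref_row n k tau (t : tabloid n k) i : (k < n)%N ->
  \sum_(j | j != i) pref tau t i j = borda_tau n k tau (row_of t i) 0.
Proof.
move=> kn; set r := row_of t i.
have -> : \sum_(j | j != i) pref tau t i j
  = #|[pred j | (r < row_of t j)%N]|%:R + tau * (#|[pred j | row_of t j == r]|%:R - 1).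
  apply: (addIr tau); rewrite -!sum_nat_bool.
  transitivity (\sum_j pref tau t i j).
    by rewrite [RHS](bigD1 i) //= addrC pref_diag.
  have -> : forall u v : rat, u + tau * (v - 1) + tau = u + tau * v by move=> u v; ring.
  rewrite mulr_sumr -big_split /=; apply: eq_bigr => j _; rewrite /pref -/r -(inj_eq val_inj) /=.
  by case: (ltngtP r (row_of t j)); rewrite ?(mulr0, mulr1, addr0, add0r).
have H := card_row_gt t r kn; move: (H); rewrite (card_row t r kn) mxE /row_size.
have rk := ltn_ord r.
case: ifP => hr H'.
  rewrite subrr mulr0 addr0 -natrB; last by lia.
  congr _%:R; lia.
have -> : #|[pred j | (r < row_of t j)%N]| = 0%N by lia.
by rewrite add0r natrB // ltnW.
Qed.

(** Losses are counted like wins. The result is written with [borda] because the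
    difference of wins and losses is [2 * borda - (n - 1)], where [tau] cancels. *)
Lemma sum_pref_col n k tau (t : tabloid n k) i : (k < n)%N ->
  \sum_(j | j != i) pref tau t j i
  = borda_tau n k tau (row_of t i) 0 - 2%:R * borda n k (row_of t i) 0 + (n%:R - 1).
Proof.
move=> kn; set r := row_of t i.
have -> : \sum_(j | j != i) pref tau t j i
  = #|[pred j | (row_of t j < r)%N]|%:R + tau * (#|[pred j | row_of t j == r]|%:R - 1).
  apply: (addIr tau); rewrite -!sum_nat_bool.
  transitivity (\sum_j pref tau t j i).
    by rewrite [RHS](bigD1 i) //= addrC pref_diag.
  have -> : forall u v : rat, u + tau * (v - 1) + tau = u + tau * v by move=> u v; ring.
  rewrite mulr_sumr -big_split /=; apply: eq_bigr => j _; rewrite /pref -/r -(inj_eq val_inj) /=.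
  by case: (ltngtP r (row_of t j)); rewrite ?(mulr0, mulr1, addr0, add0r).
rewrite card_row_lt (card_row t r kn) !mxE /row_size.
have rk := ltn_ord r.
case: ifP => hr.
  rewrite -(natr1 r); ring.
have -> : nat_of_ord r = k by lia.
by rewrite natrB 1?ltnW //; field.
Qed.

(** Grouping the scores by row shows that their sum is the same for all tabloids. *)
Definition total_pref (n k : nat) (tau : rat) : rat :=
  \sum_(r < k.+1) (row_size n k r)%:R * borda_tau n k tau r 0.

Lemma sum_pref n k tau (t : tabloid n k) : (k < n)%N ->
  \sum_i \sum_(j | j != i) pref tau t i j = total_pref n k tau.
Proof.
move=> kn; rewrite (partition_big (row_of t) predT) //=.
apply: eq_bigr => r _.
rewrite (eq_bigr (fun=> borda_tau n k tau r 0)) => [|i /eqP <-]; last exact: sum_pref_row.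
by rewrite sumr_const -(card_row t r kn) mulr_natl.
Qed.

Lemma total_pref_gt0 n k tau : (0 < k < n)%N -> 0 <= tau ->
  0 < total_pref n k tau.
Proof.
case/andP=> k0 kn tau0; rewrite /total_pref big_ord_recl /=.
apply: ltr_wpDr.
  apply: sumr_ge0 => r _; apply: mulr_ge0 => //; rewrite mxE; case: ifP => h.
    by rewrite subr_ge0 ler_nat; lia.
  by apply: mulr_ge0 => //; rewrite subr_ge0 -natrB ?ler1n; lia.
by rewrite mxE /row_size /= k0 mul1r subr_gt0 ltr_nat; lia.
Qed.

(** * Sums over pairs of candidates *)

Lemma sum_cand_pair n (F : 'I_n -> 'I_n -> rat) :
  \sum_(p : cand_pair n) F (val p).1 (val p).2
  = \sum_j \sum_(l | l != j) F j l.
Proof.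
rewrite pair_big_dep /=.
rewrite (reindex_omap (val : {p : 'I_n * 'I_n | p.1 != p.2} -> _) insub) /=.
  apply: eq_bigl => p; rewrite valK eqxx andbT eq_sym.
  by rewrite (valP p).
by move=> p hp; rewrite insubT 1?eq_sym.
Qed.

Lemma sum_cand_pair_fst n (i : 'I_n) (F : 'I_n -> 'I_n -> rat) :
  \sum_(p : cand_pair n | (val p).1 == i) F (val p).1 (val p).2
  = \sum_(l | l != i) F i l.
Proof.
rewrite big_mkcond (sum_cand_pair (fun j l => if j == i then F j l else 0)).
rewrite (bigD1 i) //= [X in _ + X]big1 ?addr0 => [|j /negPf ji].
  by apply: eq_bigr => l _; rewrite eqxx.
by rewrite big1 // => l _; rewrite ji.
Qed.

Lemma sum_cand_pair_snd n (i : 'I_n) (F : 'I_n -> 'I_n -> rat) :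
  \sum_(p : cand_pair n | (val p).2 == i) F (val p).1 (val p).2
  = \sum_(j | j != i) F j i.
Proof.
rewrite big_mkcond (sum_cand_pair (fun j l => if l == i then F j l else 0)).
rewrite [RHS]big_mkcond /=; apply: eq_bigr => j _.
rewrite -big_mkcondr /=; case: eqVneq => [->|ji].
  by rewrite big_pred0 // => l; rewrite andNb.
rewrite (big_pred1 i) // => l /=; case: (eqVneq l i) => [->|]; last by rewrite andbF.
by rewrite andbT eq_sym.
Qed.

(** Recoverability only has to be tested on basis tabloids, and a linear map out of
    the space of pairs is a matrix [K] indexed by candidates and pairs. *)
Lemma recoverable_pairsP n k (w : 'cV[rat]_k.+1) tau :
  recoverable (positional n w) (pairs_map n k tau) <->
  exists K : 'I_n -> cand_pair n -> rat, forall (t : tabloid n k) i,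
    w (row_of t i) 0 = \sum_p K i p * pref tau t (val p).1 (val p).2.
Proof.
split=> [[R RE]|[K KE]].
  exists (fun i p => R [ffun c => (c == p)%:R] i 0) => t i.
  have := RE [ffun c => (c == t)%:R]; rewrite /= !linext_basis => /matrixP/(_ i 0).
  rewrite mxE => ->.
  have {1}-> : pairs_vector tau t =
     \sum_p pref tau t (val p).1 (val p).2 *: [ffun c => (c == p)%:R : rat^o].
    apply/ffunP => p; rewrite sum_ffunE (bigD1 p) //= big1 ?addr0 => [|q qp].
      by rewrite !ffunE eqxx [_ *: _]mulr1.
    by rewrite !ffunE eq_sym (negPf qp) [_ *: _]mulr0.
  rewrite linear_sum summxE; apply: eq_bigr => p _.
  by rewrite linearZ mxE mulrC.
exists (linext (fun p => \col_i K i p)) => x /=.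
rewrite {1 3}/linext linear_sum; apply: eq_bigr => t _.
rewrite linearZ; congr (_ *: _); apply/matrixP => i z; rewrite ord1 mxE KE.
rewrite /= /linext summxE; apply: eq_bigr => p _.
by rewrite !mxE ffunE mulrC.
Qed.

(** * The action of permutations of the candidates *)

Section Action.
Variables (n k : nat).

Lemma tabloid_act_subproof (s : {perm 'I_n}) (t : tabloid n k) :
  uniq (map_tuple s (val t)).
Proof. by rewrite map_inj_uniq ?(valP t) //; apply: perm_inj. Qed.

Definition tabloid_act (s : {perm 'I_n}) (t : tabloid n k) : tabloid n k :=
  exist _ (map_tuple s (val t)) (tabloid_act_subproof s t).

Lemma row_of_act s t i : row_of (tabloid_act s t) (s i) = row_of t i.
Proof. by rewrite /row_of /= index_map //; apply: perm_inj. Qed.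

Lemma tabloid_act_inj s : injective (tabloid_act s).
Proof.
move=> t u /(congr1 (fun x => val (val x))) /= /inj_map E.
by apply/val_inj/val_inj/E; apply: perm_inj.
Qed.

Lemma pref_act tau s t i j :
  pref tau (tabloid_act s t) (s i) (s j) = pref tau t i j.
Proof. by rewrite /pref !row_of_act. Qed.

(** Start from the tabloid that lists the first [k] candidates in order, where
    candidate [r] is in row [r], and exchange candidates [r] and [i]. *)
Lemma exists_row (i : 'I_n) (r : 'I_k.+1) : (k < n)%N ->
  exists t : tabloid n k, row_of t i = r.
Proof.
move=> kn.
have inj : injective (widen_ord (ltnW kn)) by move=> a b [ab]; apply: val_inj.
have ut : uniq (map_tuple (widen_ord (ltnW kn)) (ord_tuple k)).
  by rewrite map_inj_uniq // enum_uniq.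
pose t0 : tabloid n k := exist (fun u : k.-tuple _ => uniq u) _ ut.
have rn : (r < n)%N by exact: leq_trans (ltn_ord r) kn.
pose j := Ordinal rn.
exists (tabloid_act (tperm j i) t0).
rewrite -[X in row_of _ X](tpermL j i) row_of_act; apply: val_inj; rewrite /= row_ofE /=.
have [rk|kr] := ltnP r k.
  have -> : j = widen_ord (ltnW kn) (Ordinal rk) by apply: val_inj.
  by rewrite index_map // index_enum_ord.
have -> : nat_of_ord r = k by have := ltn_ord r; lia.
rewrite memNindex ?size_map -?enumT ?size_enum_ord //.
apply/mapP => -[a _ /(congr1 val) /= E]; have := ltn_ord a; lia.
Qed.

Definition pref_sum (tau : rat) (i : 'I_n) (r : 'I_k.+1) (j l : 'I_n) : rat :=
  \sum_(t : tabloid n k | row_of t i == r) pref tau t j l.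

(** The action of a permutation fixing [i] permutes the tabloids summed over. *)
Lemma pref_sum_perm tau i r j l (s : {perm 'I_n}) : s i = i ->
  pref_sum tau i r (s j) (s l) = pref_sum tau i r j l.
Proof.
move=> si; rewrite /pref_sum (reindex_inj (@tabloid_act_inj s)) /=.
by apply: eq_big => t => [|_]; rewrite ?pref_act // -{1}si row_of_act.
Qed.

Lemma pref_sum_fst tau i r j j' : j != i -> j' != i ->
  pref_sum tau i r i j = pref_sum tau i r i j'.
Proof.
move=> ji j'i; have si : tperm j j' i = i by rewrite tpermD.
by rewrite -(pref_sum_perm tau r i j si) si tpermL.
Qed.

Lemma pref_sum_snd tau i r j j' : j != i -> j' != i ->
  pref_sum tau i r j i = pref_sum tau i r j' i.
Proof.
move=> ji j'i; have si : tperm j j' i = i by rewrite tpermD.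
by rewrite -(pref_sum_perm tau r j i si) si tpermL.
Qed.

(** The permutations fixing [i] are transitive on ordered pairs avoiding [i]:
    [tperm j j'] takes [(j, l)] to some [(j', m)], and [tperm m l'] takes that
    to [(j', l')] without moving [j']. *)
Lemma pref_sum_other tau i r j l j' l' :
  j != l -> j != i -> l != i -> j' != l' -> j' != i -> l' != i ->
  pref_sum tau i r j l = pref_sum tau i r j' l'.
Proof.
move=> jl ji li j'l' j'i l'i.
pose m := tperm j j' l.
have jm : m != j' by rewrite -(tpermL j j') (inj_eq perm_inj) eq_sym.
have si : tperm j j' i = i by rewrite tpermD.
have mi : m != i by rewrite -si (inj_eq perm_inj).
have ui : tperm m l' i = i by rewrite tpermD.
rewrite -(pref_sum_perm tau r j l si) tpermL -/m.
by rewrite -(pref_sum_perm tau r j' m ui) tpermL (@tpermD _ m l' j') // eq_sym.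
Qed.

End Action.

(** * Characterisation of the recoverable weights *)

(** Only the average of [K] matters against a function that is constant on [Q].
    When [Q] is empty, both sides vanish. *)
Lemma sum_mul_const (T : finType) (Q : pred T) (K A : T -> rat) :
  (forall x y, Q x -> Q y -> A x = A y) ->
  \sum_(x | Q x) K x * A x
  = (\sum_(x | Q x) K x) / #|Q|%:R * \sum_(x | Q x) A x.
Proof.
move=> AE; have [x0 Qx0|Q0] := pickP Q; last by rewrite !big_pred0 // !mul0r.
rewrite (eq_bigr (fun x => K x * A x0)) => [|x Qx]; last by rewrite (AE x x0).
rewrite [X in _ * X](eq_bigr (fun=> A x0)) => [|x Qx]; last exact: AE.
rewrite sumr_const -mulr_suml -[A x0 *+ _]mulr_natl mulrA divfK //.
by rewrite pnatr_eq0 -lt0n; apply/card_gt0P; exists x0.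
Qed.

(** One candidate [i] is enough, since each row contains [i] in some tabloid. *)
Lemma weights_of_recoverable n k (w : 'cV[rat]_k.+1) tau (i : 'I_n)
    (K : cand_pair n -> rat) : (k < n)%N ->
  (forall t : tabloid n k,
    w (row_of t i) 0 = \sum_p K p * pref tau t (val p).1 (val p).2) ->
  exists a c d, forall r,
    w r 0 = a * borda n k r 0 + c * borda_tau n k tau r 0 + d.
Proof.
move=> kn KE.
(* The three orbits on pairs of the permutations that fix [i]. *)
pose Q1 := [pred p : cand_pair n | (val p).1 == i].
pose Q2 := [pred p : cand_pair n | (val p).2 == i].
pose Q3 := [pred p : cand_pair n | ((val p).1 != i) && ((val p).2 != i)].
pose rho (Q : pred (cand_pair n)) : rat := (\sum_(p | Q p) K p) / #|Q|%:R.
have split3 (F : cand_pair n -> rat) :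
    \sum_p F p = \sum_(p | Q1 p) F p + \sum_(p | Q2 p) F p + \sum_(p | Q3 p) F p.
  rewrite (bigID Q1) /= -addrA; congr (_ + _).
  rewrite (bigID Q2) /=; congr (_ + _).
  apply: eq_bigl => p /=; case: (eqVneq (val p).2 i) => [p2|]; last by rewrite andbF.
  by rewrite andbT -p2; apply: (valP p).
pose b r := borda n k r 0; pose bt r := borda_tau n k tau r 0.
pose ls r := bt r - 2%:R * b r + (n%:R - 1).
have wE r : w r 0 = rho Q1 * bt r + rho Q2 * ls r
                    + rho Q3 * (total_pref n k tau - bt r - ls r).
  pose N : rat := #|[pred t : tabloid n k | row_of t i == r]|%:R.
  have N0 : N != 0.
    have [t tr] := exists_row i r kn.
    by rewrite pnatr_eq0 -lt0n; apply/card_gt0P; exists t; rewrite inE tr.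
  (* Sum the equation for [w] over the [N] tabloids with [i] in row [r]. *)
  apply: (mulfI N0).
  pose A (p : cand_pair n) := pref_sum tau i r (val p).1 (val p).2.
  have sumA (Q : pred (cand_pair n)) v :
      (forall t : tabloid n k, row_of t i = r ->
         \sum_(p | Q p) pref tau t (val p).1 (val p).2 = v) ->
      \sum_(p | Q p) A p = N * v.
    move=> Ht; rewrite exchange_big /= (eq_bigr (fun=> v)) => [|t /eqP]; last exact: Ht.
    by rewrite sumr_const mulr_natl.
  have S1 t : row_of t i = r ->
      \sum_(p | Q1 p) pref tau t (val p).1 (val p).2 = bt r.
    by move=> <-; rewrite (sum_cand_pair_fst i (pref tau t)) sum_pref_row.
  have S2 t : row_of t i = r ->
      \sum_(p | Q2 p) pref tau t (val p).1 (val p).2 = ls r.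
    by move=> <-; rewrite (sum_cand_pair_snd i (pref tau t)) sum_pref_col.
  have S3 t : row_of t i = r ->
      \sum_(p | Q3 p) pref tau t (val p).1 (val p).2
      = total_pref n k tau - bt r - ls r.
    move=> tr; rewrite -(sum_pref tau t kn) -(sum_cand_pair (pref tau t)) split3.
    by rewrite (S1 t tr) (S2 t tr); ring.
  transitivity (\sum_p K p * A p).
    rewrite /A /pref_sum; under eq_bigr do rewrite mulr_sumr.
    rewrite exchange_big /= (eq_bigr (fun=> w r 0)) => [|t /eqP <-]; last by rewrite -KE.
    by rewrite sumr_const mulr_natl.
  rewrite split3 !sum_mul_const -/(rho Q1) -/(rho Q2) -/(rho Q3).
  - rewrite (sumA _ _ S1) (sumA _ _ S2) (sumA _ _ S3); ring.
  - move=> p q /andP[p1 p2] /andP[q1 q2].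
    by apply: pref_sum_other => //; [apply: (valP p)|apply: (valP q)].
  - move=> p q /eqP p2 /eqP q2; rewrite /A p2 q2.
    by apply: pref_sum_snd; [rewrite -{1}p2; apply: (valP p)|rewrite -{1}q2; apply: (valP q)].
  - move=> p q /eqP p1 /eqP q1; rewrite /A p1 q1.
    by apply: pref_sum_fst; rewrite eq_sym; [rewrite -{1}p1; apply: (valP p)|rewrite -{1}q1; apply: (valP q)].
exists (2%:R * (rho Q3 - rho Q2)), (rho Q1 + rho Q2 - 2%:R * rho Q3).
exists (rho Q2 * (n%:R - 1) + rho Q3 * (total_pref n k tau - (n%:R - 1))) => r.
rewrite wE /ls /b /bt; ring.
Qed.

(** The recovery matrix combines, for each candidate, its wins, its losses and the
    constant sum of all entries, divided by its value to produce [1]. Solving for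
    [borda] in terms of wins and losses gives the coefficients. *)
Lemma recoverable_of_weights n k (w : 'cV[rat]_k.+1) tau a c d :
  (0 < k < n)%N -> 0 <= tau ->
  (forall r, w r 0 = a * borda n k r 0 + c * borda_tau n k tau r 0 + d) ->
  recoverable (positional n w) (pairs_map n k tau).
Proof.
move=> /[dup] /andP[_ kn] hk tau0 wE.
have T0 := lt0r_neq0 (total_pref_gt0 hk tau0).
apply/recoverable_pairsP.
pose g := (d + a / 2%:R * (n%:R - 1)) / total_pref n k tau.
exists (fun i p => (c + a / 2%:R) * ((val p).1 == i)%:R
                   - a / 2%:R * ((val p).2 == i)%:R + g) => t i.
have S1 : \sum_(p : cand_pair n) ((val p).1 == i)%:R * pref tau t (val p).1 (val p).2
          = borda_tau n k tau (row_of t i) 0.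
  rewrite -(sum_pref_row tau t i kn) -(sum_cand_pair_fst i (pref tau t)) [RHS]big_mkcond.
  by apply: eq_bigr => p _; case: eqP; rewrite ?mul1r ?mul0r.
have S2 : \sum_(p : cand_pair n) ((val p).2 == i)%:R * pref tau t (val p).1 (val p).2
          = borda_tau n k tau (row_of t i) 0 - 2%:R * borda n k (row_of t i) 0 + (n%:R - 1).
  rewrite -(sum_pref_col tau t i kn) -(sum_cand_pair_snd i (pref tau t)) [RHS]big_mkcond.
  by apply: eq_bigr => p _; case: eqP; rewrite ?mul1r ?mul0r.
have S3 := sum_pref tau t kn; rewrite -(sum_cand_pair (pref tau t)) in S3.
under eq_bigr do rewrite mulrDl mulrBl -!mulrA.
rewrite big_split sumrB /= -!mulr_sumr S1 S2 S3 wE /g.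
by field.
Qed.

(** * Projection along the constant vector *)

Lemma hatE n (v : 'cV[rat]_n) i : hat v i 0 = v i 0 - n%:R^-1 * \sum_j v j 0.
Proof. by rewrite !mxE mulr1. Qed.

Lemma hat_lin2 n (u v : 'cV[rat]_n) a c :
  hat (a *: u + c *: v) = a *: hat u + c *: hat v.
Proof.
apply/matrixP => i z; rewrite ord1 !(hatE, mxE).
under eq_bigr do rewrite !mxE.
rewrite big_split /= -!mulr_sumr; ring.
Qed.

Lemma eq_hatP n (u v : 'cV[rat]_n) : (0 < n)%N ->
  hat u = hat v <-> exists d, forall i, u i 0 = v i 0 + d.
Proof.
move=> n0; split=> [E|[d E]].
  exists (n%:R^-1 * \sum_j u j 0 - n%:R^-1 * \sum_j v j 0) => i.
  move: (congr1 (fun M : 'cV_n => M i 0) E); rewrite !hatE => Ei; lra.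
apply/matrixP => i z; rewrite ord1 !hatE; under eq_bigr do rewrite E.
rewrite E big_split /= sumr_const card_ord -[d *+ n]mulr_natl.
field; by rewrite pnatr_eq0 -lt0n.
Qed.

Lemma extendE n k (w : 'cV[rat]_k.+1) (i : 'I_n) :
  extend n w i 0 = w (inord (minn i k)) 0.
Proof.
rewrite mxE /minn; case: ifP => // _.
by congr (w _ 0); apply: val_inj; rewrite /= inordK.
Qed.

(** As [k < n], every row index occurs in [extend], so a relation between extended
    vectors is one between weighting vectors. *)
Lemma hat_extend_span n k (w u v : 'cV[rat]_k.+1) a c : (k < n)%N ->
  hat (extend n w) = a *: hat (extend n u) + c *: hat (extend n v) <->
  exists d, forall r, w r 0 = a * u r 0 + c * v r 0 + d.
Proof.
move=> kn; have n0 : (0 < n)%N by apply: leq_ltn_trans kn.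
have combE (i : 'I_n) : (a *: extend n u + c *: extend n v) i 0
    = a * u (inord (minn i k)) 0 + c * v (inord (minn i k)) 0.
  rewrite -!extendE mxE; congr (_ + _); exact: mxE.
rewrite -hat_lin2; split=> [/(eq_hatP _ _ n0)[d E]|[d E]].
  exists d => r; have rn : (r < n)%N by apply: leq_trans (ltn_ord r) kn.
  have := E (Ordinal rn); rewrite combE extendE /=.
  have /minn_idPl-> : (r <= k)%N by rewrite -ltnS.
  by rewrite inord_val.
apply/(eq_hatP _ _ n0); exists d => i.
by rewrite combE extendE E.
Qed.

Theorem theorem9 (n k : nat) (hk1 : (1 <= k)%N) (hk2 : (k <= n - 2)%N)
    (w : 'cV[rat]_k.+1) (tau : rat) (htau : 0 <= tau <= 1) :
  recoverable (positional n w) (pairs_map n k tau)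
  <-> exists a c : rat,
        hat (extend n w)
        = a *: hat (extend n (borda n k))
          + c *: hat (extend n (borda_tau n k tau)).
Proof.
have kn : (k < n)%N by lia.
case/andP: htau => tau0 _.
split=> [/recoverable_pairsP[K KE]|[a [c /(hat_extend_span _ _ _ _ _ kn)[d wE]]]].
  have n0 : (0 < n)%N by lia.
  have [a [c [d wE]]] := weights_of_recoverable kn (fun t => KE t (Ordinal n0)).
  by exists a, c; apply/hat_extend_span => //; exists d.
by apply: (recoverable_of_weights (a := a) (c := c) (d := d)) => //; rewrite hk1.
Qed.
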